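(* There is an absolute constant $c>0$ such that the following holds for every even integer $n\ge 4$. The number of different sizes of $[3,1]$-avoiders in $\mathbb{F}_2^n$ given by the code-based construction, that is, the number of distinct values $|S_C(3)|$ as $C$ ranges over all binary linear codes $C\le\mathbb{F}_2^{n/2}$, is at least $$\binom{\left\lfloor(n-4)/4\right\rfloor}{\left\lfloor(n-4)/8\right\rfloor}^{1/3}\ \ge\ c\cdot\frac{2^{n/12}}{\sqrt{n}}.$$
   Context: A $k$-flat of $\mathbb{F}_2^n$ is a $k$-dimensional affine subspace. A set $S\subseteq \mathbb{F}_2^n$ is a $[k,t]$-avoider if there is no $k$-flat $F\subseteq\mathbb{F}_2^n$ with $|S\cap F|=t$. A binary linear code of length $\ell$ is a linear subspace of $\mathbb{F}_2^{\ell}$. Code-based construction: let $k\ge 3$ and $\ell\ge 1$ be integers, let $C\le\mathbb{F}_2^{\ell}$ be a binary linear code, and let $n=\ell(k-1)$. For $1\le i\le \ell$ let $$F_i=\{\mathbf{x}\in\mathbb{F}_2^n:\ \mathbf{x}_j=1 \text{ for all } j \text{ with } (i-1)(k-1)+1\le j\le i(k-1)\},$$ and let $I_i:\mathbb{F}_2^n\to\mathbb{F}_2$ be the indicator function of $F_i$ (so $I_i(\mathbf{x})=1$ if $\mathbf{x}\in F_i$ and $I_i(\mathbf{x})=0$ otherwise). Let $\mathbf{s}(\mathbf{x})=(I_1(\mathbf{x}),\dots,I_\ell(\mathbf{x}))\in\mathbb{F}_2^{\ell}$. The set $S_C(k)\subseteq\mathbb{F}_2^n$ is defined by $\mathbf{x}\in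 S_C(k)\Leftrightarrow \mathbf{s}(\mathbf{x})\notin C$. The $[k,1]$-avoiders in $\mathbb{F}_2^n$ given by the code-based construction are the sets $S_C(k)$ for binary linear codes $C\le\mathbb{F}_2^{\ell}$ with $\ell=n/(k-1)$. For $k=3$ this means $\ell=n/2$. *)

(* Defs.v *)
From HB Require Import structures.
From mathcomp Require Import all_boot all_order all_algebra finmap.
From mathcomp Require Import all_classical all_reals all_analysis.
Set Implicit Arguments.
Unset Strict Implicit.
Unset Printing Implicit Defensive.
Import Order.TTheory GRing.Theory Num.Theory.
Local Open Scope ring_scope.

Definition is_flat (n k : nat) (F : {set 'rV['F_2]_n}) : Prop :=
  exists v : 'rV['F_2]_n, exists2 U : {vspace 'rV['F_2]_n},
    \dim U = k & F = [set v + u | u in U].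

Definition is_avoider (n k t : nat) (S : {set 'rV['F_2]_n}) : Prop :=
  forall F : {set 'rV['F_2]_n}, is_flat k F -> #|S :&: F| <> t.

(* Coordinates and blocks are numbered from 0, so block i consists of the
   coordinates i(k-1), ..., (i+1)(k-1)-1.  In block_flat, syndrome and code_set
   the dimension n is a separate argument, so that code_set is literally a
   subset of F_2^n; it is meant to be used with n = l(k-1). *)
Definition block_flat (k n i : nat) : {set 'rV['F_2]_n} :=
  [set x : 'rV['F_2]_n |
    [forall j : 'I_n, (i * k.-1 <= j < i.+1 * k.-1)%N ==> (x ord0 j == 1)]].

Definition syndrome (k l n : nat) (x : 'rV['F_2]_n) : 'rV['F_2]_l :=
  \row_(i < l) (x \in block_flat k n i)%:R.

Definition code_set (k l n : nat) (C : {vspace 'rV['F_2]_l}) :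
    {set 'rV['F_2]_n} :=
  [set x : 'rV['F_2]_n | syndrome k l x \notin C].

Definition code_sizes (k n : nat) : set nat :=
  range (fun C : {vspace 'rV['F_2]_(n %/ k.-1)} => #|code_set k n C|).

Lemma finite_code_sizes (k n : nat) : finite_set (code_sizes k n).
Proof.
apply: (sub_finite_set _ (finite_II #|{: 'rV['F_2]_n}|.+1)).
by move=> _ [C _ <-] /=; rewrite ltnS max_card.
Qed.

Lemma sum_block_flat (k l n : nat) (F : {set 'rV['F_2]_n}) (i : 'I_l) :
  (0 < k)%N -> n = (l * k.-1)%N -> is_flat k F ->
  \sum_(x in F) (x \in block_flat k n i)%:R = 0 :> 'F_2.
Proof.
move=> k_gt0 def_n [v [U dimU ->]].
have lt_n (t : 'I_k.-1) : (i * k.-1 + t < n)%N.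
  rewrite def_n; apply: (@leq_trans (i.+1 * k.-1)).
    by rewrite mulSn addnC ltn_add2r.
  by rewrite leq_mul2r ltn_ord orbT.
pose f (x : 'rV['F_2]_n) : 'rV['F_2]_k.-1 := \row_t x ord0 (Ordinal (lt_n t)).
have f_lin : linear f by move=> a x y; apply/rowP => t; rewrite !mxE.
pose fL := GRing.isLinear.Build _ _ _ _ f f_lin.
pose g : {linear 'rV['F_2]_n -> 'rV['F_2]_k.-1} := HB.pack f fL.
have kerU : (U :&: lker (linfun g))%VS != 0%VS.
  apply/eqP => ker0; have := limg_ker_dim (linfun g) U.
  rewrite ker0 dimv0 add0n dimU => dimI.
  have := dimvS (subvf (linfun g @: U)%VS).
  by rewrite dimI dimvf /dim /= mul1n leqNgt ltn_predL k_gt0.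
have := memv_pick (U :&: lker (linfun g))%VS.
have := kerU; rewrite -vpick0; set u := vpick _ => u_neq0.
rewrite memv_cap memv_ker lfunE => /andP[uU /eqP gu0].
have u0 (j : 'I_n) : (i * k.-1 <= j < i.+1 * k.-1)%N -> u ord0 j = 0.
  case/andP=> lb ub.
  have lt_t : (j - i * k.-1 < k.-1)%N by rewrite ltn_subLR // addnC -mulSn.
  move/rowP: gu0 => /(_ (Ordinal lt_t)); rewrite !mxE => <-.
  by congr (u _ _); apply: val_inj; rewrite /= subnKC.
have blockD x : (x + u \in block_flat k n i) = (x \in block_flat k n i).
  rewrite !inE; apply: eq_forallb => j.
  have [/u0 uj|//] := boolP (i * k.-1 <= j < i.+1 * k.-1)%N.
  by rewrite !mxE uj addr0.
have char2 (x : 'F_2) : x + x = 0.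
  by rewrite -mulr2n -mulr_natl (pcharf0 (pchar_Fp (isT : prime 2))) mul0r.
have uu : u + u = 0 by apply/rowP => j; rewrite !mxE char2.
have [j uj] : exists j, u ord0 j != 0.
  by case/rV0Pn: u_neq0 => j; exists j.
set A := [set v + w | w in U].
have AD x : (x + u \in A) = (x \in A).
  apply/imsetP/imsetP => -[w wU e].
    by exists (w + u); rewrite ?memvD // addrA -e -addrA uu addr0.
  by exists (w + u); rewrite ?memvD // e addrA.
rewrite (bigID (fun x : 'rV['F_2]_n => x ord0 j == 0)) /=.
rewrite [X in _ + X = _](reindex_inj (addIr u)) /=.
rewrite [X in _ + X = _](_ : _ = \sum_(x in A | x ord0 j == 0)
    (x \in block_flat k n i)%:R) ?char2 //.
apply: eq_big => [x|x _]; last by rewrite blockD.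
rewrite AD mxE; congr (_ && _).
have F2 (a : 'F_2) : a != 0 -> a = 1.
  by case: a => -[|[|m]] // lm _; apply: val_inj.
rewrite (F2 _ uj); case: (eqVneq (x ord0 j) 0) => [->|/F2 ->].
  by rewrite add0r oner_eq0.
by rewrite char2 eqxx.
Qed.

Lemma code_set_avoider (k l n : nat) (C : {vspace 'rV['F_2]_l}) :
  (0 < k)%N -> n = (l * k.-1)%N -> is_avoider k 1 (code_set k n C).
Proof.
move=> k_gt0 def_n F flatF /eqP/cards1P[y SFy].
have [yS yF] : y \in code_set k n C /\ y \in F.
  by apply/andP; rewrite -finset.in_setI SFy finset.set11.
have sum0 : \sum_(x in F) syndrome k l x = 0.
  apply/rowP => i; rewrite summxE mxE -[RHS](sum_block_flat i k_gt0 def_n flatF).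
  by apply: eq_bigr => x _; rewrite mxE.
move: yS; rewrite inE => /negP; apply.
move: sum0; rewrite (bigD1 y) //= => /eqP; rewrite addr_eq0 => /eqP ->.
rewrite memvN memv_suml // => x /andP[xF xy].
apply: contraNT xy => xS; rewrite -finset.in_set1 -SFy.
by rewrite finset.in_setI xF inE xS.
Qed.

(* Main.v *)
Require Import Defs.
From mathcomp Require Import all_boot all_order all_algebra finmap.
From mathcomp Require Import all_classical all_reals all_analysis.
From mathcomp Require Import zify lra.
Import Order.TTheory GRing.Theory Num.Theory.
Local Open Scope ring_scope.

(** Write n = 2l.  Under a uniform x each coordinate of the syndrome is 1 with
    probability 1/4, so a word c is the syndrome of 3 ^ z vectors x, where z is
    its number of zeros.  Hence |S_C(3)| = 4 ^ l - W(C), where W(C) is the sum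
    of 3 ^ z over the words of C, and the question is how many values W takes
    on the codes of length l.

    To produce many values, attach to a code an extra marked coordinate e (so
    the code is pointed), and let A and B be the parts of W over the words
    with e = 0 and e = 1, the marked coordinate itself being left out of the
    weight.  As for the two-terminal operations that build series-parallel
    graphs, there are two ways to lengthen a pointed code by one coordinate:
    - put a copy f = e of the mark, which changes (A, B) to (3A, B);
    - let f be free and replace the mark by e + f, which changes (A, B) to
      (3A + B, A + 3B).
    Start from the empty code, (A, B) = (1, 0).  Then always B < A, and the
    ratio B / A lies in [0, 1/3) after a step of the first kind and in [1/3, 1)
    after a step of the second kind.  Both steps being invertible, the pair
    (A, B) determines the sequence of steps of given length (enumerator_inj): it takes
    2 ^ (l - 1) values after l - 1 steps.

    The subcodes e = 0 of the two extensions have W equal to 3A and 3A + B.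
    So (A, B) is determined by two sizes |S_C(3)|, and the number V of sizes
    satisfies V ^ 2 >= 2 ^ (l - 1) (leq_card_code_sizes).  With
    N = floor((n - 4) / 4) this gives V >= 2 ^ N, which dominates the binomial
    coefficient and a fortiori its cube root.  The second inequality follows
    from 2 ^ N <= (N + 1) 'C(N, N / 2) (exp2_leq_central_bin). *)

(** * Pointed codes and their weight enumerators *)

(** The letters of w are the steps, the last one first: true copies the mark,
    false adds a free coordinate to it.  The word c is read together with the
    value e of the mark, and a lengthened word has the new coordinate in
    front. *)
Fixpoint pointed_code (w c : seq bool) (e : bool) : bool :=
  match w, c with
  | [::], [::] => ~~ e
  | true :: w', f :: c' => (f == e) && pointed_code w' c' e
  | false :: w', f :: c' => pointed_code w' c' (e (+) f)
  | _, _ => false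
  end.

(** The value at e is the sum of 3 ^ (number of zeros of c) over the words c
    whose mark is e; sum_pointed_code justifies the recursion. *)
Fixpoint enumerator (w : seq bool) (e : bool) : nat :=
  match w with
  | [::] => ~~ e
  | true :: w' => (if e then 1 else 3) * enumerator w' e
  | false :: w' => 3 * enumerator w' e + enumerator w' (~~ e)
  end%N.

Lemma pointed_code0 (I : Type) (s : seq I) (w : seq bool) :
  size w = size s -> pointed_code w [seq false | _ <- s] false.
Proof. by elim: w s => [|[] w IHw] [|i s] //= [/IHw]. Qed.

Lemma pointed_codeD (I : Type) (s : seq I) (f g : I -> bool) (w : seq bool)
    (d e : bool) :
  pointed_code w (map f s) d -> pointed_code w (map g s) e ->
  pointed_code w [seq f i (+) g i | i <- s] (d (+) e).
Proof.
elim: w s d e => [|[] w IHw] [|i s] //= d e; first by case: d e => [] [].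
  by move=> /andP[/eqP-> Hf] /andP[/eqP-> Hg]; rewrite eqxx IHw.
by move=> Hf Hg; rewrite addbACA IHw.
Qed.

Lemma big_tuple_cons (T : finType) (m : nat) (F : m.+1.-tuple T -> nat) :
  (\sum_x F x = \sum_t \sum_(x : m.-tuple T) F [tuple of t :: x])%N.
Proof.
rewrite pair_big /=.
rewrite (reindex (fun p : T * m.-tuple T => [tuple of p.1 :: p.2])) //=.
exists (fun x : m.+1.-tuple T => (thead x, [tuple of behead x])) => [[t x] _|x _] /=.
  by congr (_, _); apply: val_inj.
by rewrite [RHS]tuple_eta; apply: val_inj.
Qed.

(** A pair of bits has conjunction 0 in three cases and 1 in one case, whence
    the weight 3 of a zero. *)
Lemma sum_pointed_code (w : seq bool) (m : nat) (e : bool) : size w = m ->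
  (\sum_(x : m.-tuple (bool * bool))
     pointed_code w [seq p.1 && p.2 | p <- x] e)%N = enumerator w e.
Proof.
move=> <-{m}; elim: w e => [|a w IHw] e /=.
  rewrite (big_pred1 [tuple]) // => x; apply/esym/eqP; exact: tuple0.
rewrite big_tuple_cons -(pair_big xpredT xpredT
  (fun b c => \sum_x pointed_code (a :: w)
     (map (fun p : bool * bool => p.1 && p.2) ((b, c) :: tval x)) e)%N) /=.
rewrite !big_bool /=.
case: a e => [] [] /=; rewrite ?big1_eq !IHw; lia.
Qed.

Lemma enumerator_lt (w : seq bool) :
  (enumerator w true < enumerator w false)%N.
Proof. by elim: w => [|[] w IHw] //=; lia. Qed.

(** The last step is recognised by comparing 3B with A: 3B' = 3B < 3A = A'
    after copying the mark, and 3B' = 3A + 9B >= 3A + B = A' otherwise. *)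
Lemma enumerator_inj (v w : seq bool) : size v = size w ->
  enumerator v =1 enumerator w -> v = w.
Proof.
elim: v w => [|a v IHv] [|b w] //= [sz] eq_vw.
move: (eq_vw false) (eq_vw true) (enumerator_lt v) (enumerator_lt w).
case: a b {eq_vw} => [] [] /= e0 e1 lt_v lt_w; try lia;
  by congr (_ :: _); apply: IHv => // -[]; lia.
Qed.

(** * From pointed codes to linear codes and sizes *)

Lemma F2_cases (a : 'F_2) : a = (a == 1)%:R.
Proof. by case: a => [[|[|m]] lt_m]; apply/val_inj. Qed.

Lemma F2_addb (a b : 'F_2) : (a + b == 1) = (a == 1) (+) (b == 1).
Proof. by rewrite (F2_cases a) (F2_cases b); case: (a == 1) (b == 1) => [] []. Qed.

(** Over F_2 every linear combination is a sum of vectors, so that closure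
    under addition is enough to be a subspace. *)
Lemma F2_subspace (l : nat) (K : pred 'rV['F_2]_l) :
  K 0 -> (forall x y, K x -> K y -> K (x + y)) ->
  exists C : {vspace 'rV['F_2]_l}, forall x, (x \in C) = K x.
Proof.
move=> K0 KD; pose X := [seq x <- enum {: 'rV['F_2]_l} | K x].
exists <<in_tuple X>>%VS => x; apply/idP/idP => [|Kx]; last first.
  by apply: memv_span; rewrite mem_filter Kx mem_enum.
move=> /coord_span -> /=; apply: (big_ind K) => // i _.
rewrite [coord _ _ _]F2_cases; case: eqP => _; rewrite ?scale0r ?scale1r //.
have : X`_i \in X by apply: mem_nth.
by rewrite mem_filter => /andP[].
Qed.

Definition row_bits (l : nat) (x : 'rV['F_2]_l) : seq bool :=
  [seq x ord0 i == 1 | i <- enum 'I_l].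

Lemma pointed_code_subspace (l : nat) (w : seq bool) : size w = l ->
  exists C : {vspace 'rV['F_2]_l},
    forall x, (x \in C) = pointed_code w (row_bits l x) false.
Proof.
move=> sz_w; apply: F2_subspace => [|x y Kx Ky].
  rewrite /row_bits; under eq_map do rewrite mxE.
  by apply: pointed_code0; rewrite size_enum_ord.
rewrite /row_bits; under eq_map do rewrite mxE F2_addb.
exact: (pointed_codeD _ _ _ _ _ _ _ Kx Ky).
Qed.

(** The two coordinates of a block are gathered into a pair, which identifies
    the vectors of F_2^n with the tuples counted by sum_pointed_code. *)
Section Blocks.
Variables (l n : nat).
Hypothesis def_n : n = (l * 2)%N.

Lemma block_ord_subproof (b : bool) (i : 'I_l) : (i * 2 + b < n)%N.
Proof. have := ltn_ord i; case: b; lia. Qed.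

Definition block_ord b i : 'I_n := Ordinal (block_ord_subproof b i).

Definition block_bits (x : 'rV['F_2]_n) : l.-tuple (bool * bool) :=
  [tuple (x ord0 (block_ord false i) == 1, x ord0 (block_ord true i) == 1)
   | i < l].

Lemma block_bits_inj : injective block_bits.
Proof.
move=> x y eq_xy; apply/rowP => j.
have lt_j2 : (j %/ 2 < l)%N by have := ltn_ord j; lia.
have def_j : j = block_ord (odd j) (Ordinal lt_j2) by apply: val_inj => /=; lia.
have := congr1 (fun t => tnth t (Ordinal lt_j2)) eq_xy.
rewrite !tnth_mktuple => -[e0 e1]; rewrite def_j [LHS]F2_cases [RHS]F2_cases.
by case: (odd j); rewrite ?e0 ?e1.
Qed.

Lemma block_bits_bij : bijective block_bits.
Proof.
apply: inj_card_bij block_bits_inj _.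
rewrite card_tuple card_prod card_bool card_mx card_Fp // mul1n def_n.
by rewrite mulnC expnM.
Qed.

Lemma syndrome_bits (x : 'rV['F_2]_n) :
  row_bits l (syndrome 3 l x) = [seq p.1 && p.2 | p <- block_bits x].
Proof.
rewrite -[in RHS](map_tnth_enum (block_bits x)) -map_comp.
apply: eq_map => i /=; rewrite tnth_mktuple mxE /= inE /=.
rewrite [_ == 1](_ : _ = [forall j : 'I_n,
  (i * 2 <= j < i.+1 * 2)%N ==> (x ord0 j == 1)]); last by case: [forall j, _].
apply/forallP/andP => [all1|[x0 x1] j].
  split; [have := all1 (block_ord false i)|have := all1 (block_ord true i)];
    by move/implyP; apply => /=; lia.
apply/implyP => le_j.
have [e|e] : (j = i * 2 + false :> nat \/ j = i * 2 + true :> nat)%N by lia.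
  by rewrite (_ : j = block_ord false i) //; apply: val_inj.
by rewrite (_ : j = block_ord true i) //; apply: val_inj.
Qed.

Lemma card_code_set (w : seq bool) : size w = l ->
  exists C : {vspace 'rV['F_2]_l},
    (#|code_set 3 n C| + enumerator w false = 4 ^ l)%N.
Proof.
move=> sz_w; have [C memC] := pointed_code_subspace l w sz_w; exists C.
rewrite -(sum_pointed_code w l false sz_w).
rewrite (reindex block_bits) /=; last exact: onW_bij block_bits_bij.
under eq_bigr do rewrite -syndrome_bits -memC.
rewrite -sum1_card big_mkcond -big_split /=.
under eq_bigr => x _ do rewrite inE.
rewrite (eq_bigr (fun=> 1%N)) => [|x _]; last by case: (_ \in C).
by rewrite sum1_card card_mx card_Fp // mul1n def_n mulnC expnM.
Qed.

End Blocks.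

(** The witnessing injection sends m steps to the sizes obtained by adding a
    step of either kind. *)
Lemma leq_card_code_sizes (n m : nat) : n = (m.+1 * 2)%N ->
  (2 ^ m <= #|` fset_set (code_sizes 3 n)|%fset ^ 2)%N.
Proof.
move=> def_n; have def_l : (n %/ 3.-1 = m.+1)%N by rewrite def_n mulnK.
have def_n' : n = (n %/ 3.-1 * 2)%N by rewrite def_l.
set V := fset_set _.
have size_of (w : seq bool) : size w = m.+1 ->
    exists s : V, (val s + enumerator w false = 4 ^ m.+1)%N.
  rewrite -def_l => sz_w.
  have [C sC] := card_code_set _ n def_n' w sz_w.
  have VC : #|code_set 3 n C| \in V.
    by rewrite in_fset_set ?inE; [exists C | exact: finite_code_sizes].
  by exists [` VC]%fset.
have size_of_cons a (w : m.-tuple bool) :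
    exists s : V, (val s + enumerator (a :: w) false == 4 ^ m.+1)%N.
  by have [|s /eqP] := size_of (a :: w); [rewrite /= size_tuple | exists s].
pose g a w := xchoose (size_of_cons a w).
have g_inj : injective (fun w => (g true w, g false w)).
  move=> v w [gt gf]; apply/val_inj/enumerator_inj; first by rewrite !size_tuple.
  have /eqP tv := xchooseP (size_of_cons true v).
  have /eqP tw := xchooseP (size_of_cons true w).
  have /eqP fv := xchooseP (size_of_cons false v).
  have /eqP fw := xchooseP (size_of_cons false w).
  move: tv tw fv fw; rewrite -!/(g _ _) gt gf /= => tv tw fv fw.
  (* The two sizes give 3A and 3A + B, hence A and B. *)
  by case => /=; lia.
have := leq_card _ g_inj.
by rewrite card_tuple card_bool card_prod -cardfE -mulnn.
Qed.

(** * Bounds on the central binomial coefficient *)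

Lemma leq_bin_exp2 (N k : nat) : ('C(N, k) <= 2 ^ N)%N.
Proof.
elim: N k => [|N IHN] [|k]; rewrite ?bin0 ?expn_gt0 //.
by rewrite binS expnS mul2n -addnn leq_add.
Qed.

(** From N = 2k to 2k + 1 both sides double exactly, as
    (k + 1) 'C(2k + 1, k) = (2k + 1) 'C(2k, k); from N = 2k + 1 to 2k + 2 the
    binomial coefficient itself doubles, by Pascal's rule and symmetry. *)
Lemma exp2_leq_central_bin (N : nat) : (2 ^ N <= N.+1 * 'C(N, N %/ 2))%N.
Proof.
elim: N => // N IHN; rewrite expnS.
have [/eqP e|/eqP e] := boolP (N == (N %/ 2).*2)%N.
  have := mul_bin_left N.+1 (N %/ 2); have := mul_bin_diag N.+1 (N %/ 2).
  rewrite (_ : N.+1 %/ 2 = N %/ 2)%N /=; last by lia.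
  rewrite (_ : N.+1 - N %/ 2 = (N %/ 2).+1)%N; last by lia.
  by nia.
rewrite (_ : N.+1 %/ 2 = (N %/ 2).+1)%N; last by lia.
rewrite binS -[X in (X + _)%N]bin_sub; last by lia.
rewrite (_ : N - (N %/ 2).+1 = N %/ 2)%N; last by lia.
by nia.
Qed.

(** Since n <= 4N + 7, the number n / 12 exceeds N / 3 by less than 1: this is
    paid for by the constant 1/2.  The factor N + 1 <= n only costs
    n ^ (1/3) <= n ^ (1/2). *)
Lemma bin_powR_ge (R : realType) (n : nat) : (4 <= n)%N ->
  (2 `^ (- 1) : R) * (2 `^ (n%:R / 12) / Num.sqrt n%:R)
    <= ('C((n - 4) %/ 4, (n - 4) %/ 8)%:R : R) `^ 3^-1.
Proof.
move=> n_ge4; set N := ((n - 4) %/ 4)%N.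
have -> : ((n - 4) %/ 8 = N %/ 2)%N by rewrite /N -divnMA.
have n_gt0 : 0 < n%:R :> R by rewrite ltr0n; lia.
rewrite -powR12_sqrt ?(ltW n_gt0) // mulrA ler_pdivrMr ?powR_gt0 //.
rewrite -powRD; last by apply/implyP => _; rewrite pnatr_eq0.
have le_exp : - 1 + n%:R / 12 <= N%:R / 3 :> R.
  have : (n <= 4 * N + 7)%N by rewrite /N; lia.
  rewrite -(ler_nat R) natrD natrM; lra.
have le_exp2 : 2 `^ (N%:R / 3) <= (n%:R * 'C(N, N %/ 2)%:R) `^ 3^-1 :> R.
  rewrite powRrM powR_mulrn // ge0_ler_powR ?nnegrE ?invr_ge0 ?mulr_ge0 //.
  rewrite -natrM -natrX ler_nat (leq_trans (exp2_leq_central_bin N)) //.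
  by rewrite leq_mul2r /N; lia.
apply: le_trans (le_trans _ le_exp2) _; first by rewrite ler_powR ?ler1n.
have n_ge1 : 1 <= n%:R :> R by rewrite ler1n; lia.
by rewrite powRM // mulrC ler_wpM2l ?powR_ge0 // ler_powR //; lra.
Qed.

(** * The number of sizes *)

Theorem theorem1p6 (R : realType) :
  exists c : R, 0 < c /\
    forall n : nat, ~~ odd n -> (4 <= n)%N ->
      ('C((n - 4) %/ 4, (n - 4) %/ 8)%:R : R) `^ 3^-1
          <= (#|` fset_set (code_sizes 3 n)|%fset)%:R
      /\ c * (2 `^ (n%:R / 12) / Num.sqrt (n%:R))
          <= ('C((n - 4) %/ 4, (n - 4) %/ 8)%:R : R) `^ 3^-1.
Proof.
exists (2 `^ (-1)); split=> [|n even_n n_ge4]; first by rewrite powR_gt0.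
split; last exact: bin_powR_ge.
set N := ((n - 4) %/ 4)%N; set k := ((n - 4) %/ 8)%N; set V := #|` _|%fset.
have le_NV : (2 ^ N <= V)%N.
  have def_n : n = ((n %/ 2).-1.+1 * 2)%N by lia.
  rewrite -leq_sqr -expnM (leq_trans _ (leq_card_code_sizes _ _ def_n)) //.
  by rewrite leq_exp2l // /N; lia.
have bin_ge1 : 1 <= 'C(N, k)%:R :> R by rewrite ler1n bin_gt0 /N /k; lia.
apply: (@le_trans _ _ 'C(N, k)%:R).
  by rewrite -[leRHS]powRr1 // ler_powR // invf_le1 // ler1n.
by rewrite ler_nat (leq_trans (leq_bin_exp2 N k)).
Qed.
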